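(* There exists an absolute constant $C\in(0,\infty)$ such that for all $1\le p\le\infty$ with Hölder conjugate $p^*$, all $m\in\mathbb{N}$ and all real numbers $\sigma_1\ge\cdots\ge\sigma_m>0$, $$ \mathbb{E}\sup_{y\in\mathcal{E}_{p,\sigma}^m}\sum_{j=1}^m g_jy_j\le \begin{cases} C\sup\limits_{1\le j\le m}\sigma_j\sqrt{\log(j)+1} & \text{if } p=1,\\ C\sqrt{p^*}\,\big(\sum\limits_{j=1}^m\sigma_j^{p^*}\big)^{1/p^*} & \text{if } 1<p\le\infty, \end{cases} $$ where $g_1,\dots,g_m$ are independent standard Gaussian random variables.
   Context: For $1\le p\le\infty$, $\|\cdot\|_p$ denotes the $\ell_p$-norm on $\mathbb{R}^m$, and $\mathcal{E}_{p,\sigma}^m=\{x\in\mathbb{R}^m:\|(x_j/\sigma_j)_{j=1}^m\|_p\le 1\}$ is the $\ell_p$-ellipsoid with semiaxes $\sigma_1\ge\cdots\ge\sigma_m>0$. The Hölder conjugate satisfies $\frac1p+\frac1{p^*}=1$ (with $1/\infty=0$). *)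

(* Defs.v *)
(* MathComp-Analysis *)
From HB Require Import structures.
From mathcomp Require Import all_boot all_order all_algebra.
From mathcomp Require Import all_classical all_reals all_analysis.

Set Implicit Arguments.
Unset Strict Implicit.
Unset Printing Implicit Defensive.

Import Order.TTheory GRing.Theory Num.Theory.
Import numFieldNormedType.Exports.

Local Open Scope classical_set_scope.
Local Open Scope ring_scope.

(* Only meaningful for 1 <= p; the branch for p = -oo is a dummy. Since the
   entries are nonnegative, 0 is a harmless default for the maximum. *)
Definition lp_norm (R : realType) (m : nat) (p : \bar R) (x : 'rV[R]_m) : R :=
  match p with
  | r%:E => (\sum_(j < m) `|x 0 j| `^ r) `^ r^-1
  | +oo%E => \big[Num.max/0]_(j < m) `|x 0 j|
  | -oo%E => 0
  end.

Definition lp_ellipsoid (R : realType) (m : nat) (p : \bar R)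
    (sigma : 'I_m -> R) : set 'rV[R]_m :=
  [set x | lp_norm p (\row_(j < m) (x 0 j / sigma j)) <= 1].

Definition mutually_independent (R : realType) (d : measure_display)
    (T : measurableType d) (P : probability T R) (m : nat)
    (X : 'I_m -> {RV P >-> R}) : Prop :=
  forall (J : {set 'I_m}) (A : 'I_m -> set R),
    (forall j, measurable (A j)) ->
    P (\bigcap_(j in [set` J]) (X j @^-1` A j)) =
    (\prod_(j in J) P (X j @^-1` A j))%E.

(* The laws are compared on Borel sets only: measures are functions on all
   sets, with unconstrained values on the nonmeasurable ones. *)
Definition standard_gaussian (R : realType) (d : measure_display)
    (T : measurableType d) (P : probability T R) (X : {RV P >-> R}) : Prop :=
  forall A : set R, measurable A -> distribution P X A = normal_prob 0 1 A.

(* Indices start at 0, whence ln j.+1 for log(j). If 1 < p then the Hoelder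
   conjugate of p is finite, so that q below is p^* as a real number. *)
Definition gaussian_width_bound (R : realType) (m : nat) (p : \bar R)
    (sigma : 'I_m -> R) : R :=
  if p == 1%E then
    \big[Num.max/0]_(j < m) (sigma j * Num.sqrt (ln j.+1%:R + 1))
  else
    let q := fine (hoelder_conjugate p) in
    Num.sqrt q * (\sum_(j < m) sigma j `^ q) `^ q^-1.

(* Main.v *)
Require Import Defs.
From HB Require Import structures.
From mathcomp Require Import all_boot all_order all_algebra.
From mathcomp Require Import all_classical all_reals all_analysis.
From mathcomp Require Import measurable_realfun ring lra.

Set Implicit Arguments.
Unset Strict Implicit.
Unset Printing Implicit Defensive.

Import Order.TTheory GRing.Theory Num.Theory.
Import numFieldNormedType.Exports.

Local Open Scope classical_set_scope.
Local Open Scope ring_scope.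

(** The supremum over the ellipsoid is dominated pointwise by an affine function
    of the variables exp(g_j^2/4), whose expectation is sqrt 2 for a standard
    Gaussian g_j: the Gaussian density times exp(x^2/4) is, up to the factor
    sqrt 2, the density of the centred normal law of variance 2. Taking
    expectations is then linearity, so that neither moments nor tails of maxima
    have to be computed.

    The pointwise bounds are the following. Write psi(x) = exp(x^2/4) and
    number the coordinates from 1.

    - For 1 < p, with q the conjugate exponent and A the sum of the sigma_j^q,
      put a_j = sigma_j |x_j| / N with N = sqrt(2q) A^(1/q). Since
      t^2 <= exp(t^2), one has (|x| / sqrt(2q))^q <= psi(x)
      ([powR_sqrt_le_expR]), hence a_j^q <= (sigma_j^q / A) psi(x_j) =: u_j.
      The weights sigma_j^q / A sum to 1 and psi >= 1, so the u_j sum to at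
      least 1, and Young's inequality ([lp_ball_young]) bounds
      sum_j x_j y_j by N sum_j u_j on the ellipsoid. The expectation of this
      majorant is sqrt 2 * sqrt(2q) * A^(1/q) = 2 sqrt q A^(1/q).

    - For p = 1, the form is at most the maximum of the sigma_j |x_j|. With
      s_j = sqrt(ln j + 1) and M the maximum of the sigma_j s_j this is at most
      M times the maximum of the |x_j| / s_j, and
      |x_j| / s_j <= 3 + psi(x_j) / j^2 ([norm_div_sqrt_ln_le]): the
      logarithmic normalisation is what makes the weights 1/j^2 available, and
      these are summable. The expectation is at most
      M (3 + 2 sqrt 2).

    Both constants are below 7. *)

(** * Exponential square moment of a Gaussian variable *)

(** The density of the normal law is a version of its Radon-Nikodym derivative,
    for which the change of variables is known. *)
Lemma ge0_integral_normal_prob (R : realType) (m s : R)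
    (f : measurableTypeR R -> \bar R) :
  measurable_fun setT f -> (forall x, 0 <= f x)%E ->
  (\int[normal_prob m s]_x f x
    = \int[lebesgue_measure]_x (f x * (normal_pdf m s x)%:E))%E.
Proof.
move=> mf f0; have dom := @normal_prob_dominates R m s.
have hint := Radon_Nikodym_SigmaFinite.f_integrable dom.
have mpdf : measurable_fun setT
    (fun x : measurableTypeR R => (normal_pdf m s x)%:E).
  by apply/measurable_EFinP; exact: measurable_normal_pdf.
rewrite -(Radon_Nikodym_SigmaFinite.change_of_variables dom)//.
apply: ae_eq_integral => //.
- by apply: emeasurable_funM => //; exact: measurable_int hint.
- exact: emeasurable_funM.
- apply: ae_eqe_mul2l; apply: integral_ae_eq => // E _ mE.
  by rewrite -Radon_Nikodym_SigmaFinite.f_integral.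
Qed.

(** Multiplying the density of N(0, 1) by exp(x^2/4) gives sqrt 2 times the
    density of N(0, 2), which has total mass 1. *)
Lemma integral_standard_gaussian_expR (R : realType) d (T : measurableType d)
    (P : probability T R) (X : {RV P >-> R}) :
  standard_gaussian X ->
  (\int[P]_w (expR (X w ^+ 2 / 4))%:E = (Num.sqrt 2)%:E)%E.
Proof.
move=> gX.
(* Y is X for the copy of the Borel sigma-algebra that carries the Lebesgue
   measure; both have the same measurable sets. *)
have mX : measurable_fun setT (X : T -> measurableTypeR R).
  exact: (measurable_funP X).
pose Y : {RV P >-> measurableTypeR R} :=
  HB.pack (X : T -> measurableTypeR R) (isMeasurableFun.Build _ _ _ _ _ mX).
pose f := fun x : measurableTypeR R => (expR (x ^+ 2 / 4))%:E.
have mf : measurable_fun setT f.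
  apply/measurable_EFinP; apply: measurableT_comp => //.
  by apply: measurable_funM => //; exact: measurable_funX.
have f0 x : (0 <= f x)%E by rewrite lee_fin expR_ge0.
rewrite -[LHS](ge0_integral_distribution Y mf f0).
rewrite (@eq_measure_integral _ _ _ setT (normal_prob 0 1)); last first.
  by move=> A mA _; exact: gX.
rewrite ge0_integral_normal_prob//.
have s20 : Num.sqrt 2 != 0 :> R by rewrite gt_eqF// sqrtr_gt0.
transitivity (\int[lebesgue_measure]_x
    ((Num.sqrt 2)%:E * (normal_pdf 0 (Num.sqrt 2) x)%:E) : \bar R)%E.
  apply: eq_integral => x _; rewrite -!EFinM !normal_pdfE ?oner_eq0//.
  congr EFin; rewrite /normal_peak /normal_fun !subr0 sqr_sqrtr// expr1n.
  rewrite mulrCA -expRD mulrA; congr (_ * expR _); last by field.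
  by rewrite mul1r -mulrnAr sqrtrM// invfM mulrA divff// mul1r.
rewrite ge0_integralZl//.
- by rewrite integral_normal_pdf mule1.
- by apply/measurable_EFinP; exact: measurable_normal_pdf.
- by move=> x _; rewrite lee_fin normal_pdf_ge0.
Qed.

(** The integral of a nonnegative function is a supremum over the simple
    functions below it, hence monotone even on nonmeasurable functions. This
    dispenses with the measurability of the supremum over the ellipsoid. *)
Lemma ge0_le_integral_nomeas (R : realType) d (T : measurableType d)
    (mu : {measure set T -> \bar R}) (f1 f2 : T -> \bar R) :
  (forall x, 0 <= f1 x)%E -> (forall x, f1 x <= f2 x)%E ->
  (\int[mu]_x f1 x <= \int[mu]_x f2 x)%E.
Proof.
move=> f10 f12; rewrite !ge0_integralTE// => [|x]; last exact: le_trans (f12 x).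
apply: ereal_sup_le => _ [h hf1 <-]; exists h => //= x.
exact: le_trans (f12 x).
Qed.

(** * From pointwise to expected bounds *)

(** Reduces a bound on the Gaussian width of S to a deterministic one. The point
    0 in S makes the supremum nonnegative. *)
Lemma gaussian_width_le (R : realType) (m : nat) d (T : measurableType d)
    (P : probability T R) (g : 'I_m -> {RV P >-> R}) (S : set 'rV[R]_m)
    (a : R) (c : 'I_m -> R) :
  (forall j, standard_gaussian (g j)) -> S 0 -> 0 <= a ->
  (forall j, 0 <= c j) ->
  (forall x y : 'rV[R]_m, S y ->
    \sum_(j < m) x 0 j * y 0 j
      <= a + \sum_(j < m) c j * expR (x 0 j ^+ 2 / 4)) ->
  (\int[P]_w ereal_sup [set (\sum_(j < m) g j w * y 0%R j)%:E | y in S]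
    <= (a + Num.sqrt 2 * \sum_(j < m) c j)%:E)%E.
Proof.
move=> gg S0 a0 c0 bnd.
pose E j w : \bar R := (expR (g j w ^+ 2 / 4))%:E.
have mE j : measurable_fun setT (E j).
  apply/measurable_EFinP; apply: measurableT_comp => //.
  by apply: measurable_funM => //; exact: measurable_funX.
have E0 j w : (0 <= E j w)%E by rewrite lee_fin expR_ge0.
apply: (@le_trans _ _ (\int[P]_w (a%:E + \sum_(j < m) (c j)%:E * E j w))%E).
  apply: ge0_le_integral_nomeas => w.
    apply: ereal_sup_ubound; exists 0 => //.
    by rewrite big1// => j _; rewrite mxE mulr0.
  apply: ge_ereal_sup => _ [y Sy <-].
  have := bnd (\row_j g j w) y Sy.
  under eq_bigr do rewrite mxE; under [in leRHS]eq_bigr do rewrite mxE.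
  rewrite [X in (_ <= _ + X)%E](_ : _ =
    \sum_(j < m) (c j * expR (g j w ^+ 2 / 4))%:E)%E; last exact: eq_bigr.
  by rewrite sumEFin -EFinD lee_fin.
rewrite ge0_integralD//; last 2 first.
- by move=> w _; apply: sume_ge0 => j _; rewrite mule_ge0// lee_fin.
- by apply: emeasurable_sum => j; exact: measurable_funeM.
rewrite integral_cst//= probability_setT mule1 EFinD leeD2l//.
rewrite ge0_integral_sum//; last 2 first.
- by move=> j; exact: measurable_funeM.
- by move=> j w _; rewrite mule_ge0// lee_fin.
rewrite mulr_sumr -sumEFin; apply: lee_sum => j _.
rewrite ge0_integralZl//; last by rewrite lee_fin.
by rewrite integral_standard_gaussian_expR// EFinM muleC.
Qed.

(** * Pointwise bound for 1 < p *)

(** With t = |x| / sqrt(2q), this is t^2 <= exp(t^2) raised to the power q/2,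
    because q t^2 / 2 = x^2 / 4. *)
Lemma powR_sqrt_le_expR (R : realType) (q x : R) : 0 < q ->
  (`|x| / Num.sqrt (2 * q)) `^ q <= expR (x ^+ 2 / 4).
Proof.
move=> q0; set t := `|x| / _.
have s0 : 0 < Num.sqrt (2 * q) by rewrite sqrtr_gt0 mulr_gt0.
have t0 : 0 <= t by rewrite divr_ge0// ltW.
have [->|tn0] := eqVneq t 0; first by rewrite powR0 ?gt_eqF// expR_ge0.
have tp : 0 < t by rewrite lt_neqAle eq_sym tn0.
rewrite /powR (negbTE tn0) ler_expR.
have -> : x ^+ 2 / 4 = q * (t ^+ 2 / 2).
  rewrite /t expr_div_n real_normK ?num_real// sqr_sqrtr ?mulr_ge0 ?ltW//.
  by field; rewrite gt_eqF.
rewrite ler_pM2l// ler_pdivlMr// mulr_natr -lnXn//.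
by rewrite ltW// ln_sublinear// exprn_gt0.
Qed.

(** By Young's inequality a_j |b_j| <= a_j^q / q + |b_j|^p / p, the left-hand
    side is at most (sum u) / q + 1 / p; as sum u >= 1, this is at most
    (sum u) (1/q + 1/p). For p = +oo, where q = 1, each |b_j| is at most 1. *)
Lemma lp_ball_young (R : realType) (m : nat) (p : \bar R) (a u : 'I_m -> R)
    (b : 'rV[R]_m) (q := fine (hoelder_conjugate p)) :
  (1 < p)%E -> lp_norm p b <= 1 -> (forall j, 0 <= a j) ->
  (forall j, a j `^ q <= u j) -> 1 <= \sum_(j < m) u j ->
  \sum_(j < m) a j * `|b 0 j| <= \sum_(j < m) u j.
Proof.
rewrite {}/q; case: p => [r| |]//= => p1 bp a0 au u1; last first.
  apply: ler_sum => j _; have := au j; rewrite powRr1//.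
  apply: le_trans; rewrite ler_piMr//; apply: le_trans bp.
  exact: le_bigmax.
have {}p1 : 1 < r by rewrite -lte_fin.
have r0 : 0 < r by apply: lt_trans p1.
pose q := r / (r - 1).
have qE : fine (hoelder_conjugate r%:E) = q.
  by rewrite /hoelder_conjugate/= eqe gt_eqF// inver subr_eq0 gt_eqF.
rewrite qE in au.
have q0 : 0 < q by rewrite divr_gt0// subr_gt0.
have rq : q^-1 + r^-1 = 1 by rewrite /q; field; rewrite !gt_eqF// subr_gt0.
have {}bp : \sum_(j < m) `|b 0 j| `^ r <= 1.
  have ri0 : 0 < r^-1 by rewrite invr_gt0.
  rewrite leNgt; apply/negP => /(gt0_ltr_powR ri0).
  rewrite powR1 !nnegrE ler01 sumr_ge0 => [/(_ isT isT)|j _]; last exact: powR_ge0.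
  by rewrite ltNge bp.
apply: (@le_trans _ _ (\sum_(j < m) (u j / q + `|b 0 j| `^ r / r))).
  apply: ler_sum => j _.
  apply: (le_trans (conjugate_powR (a0 j) (normr_ge0 _) q0 r0 rq)).
  by rewrite lerD2r ler_pM2r ?invr_gt0.
rewrite big_split/= -!mulr_suml -[leRHS]mulr1 -rq mulrDr lerD2l.
by rewrite ler_pM2r ?invr_gt0// (le_trans bp).
Qed.

Lemma sum_mul_div_le (R : realType) (m : nat) (sigma : 'I_m -> R)
    (x y : 'rV[R]_m) :
  (forall j, 0 < sigma j) ->
  \sum_(j < m) x 0 j * y 0 j <=
  \sum_(j < m) (sigma j * `|x 0 j|) * `|(\row_j (y 0 j / sigma j)) 0 j|.
Proof.
move=> s0; apply: ler_sum => j _; rewrite mxE normrM normfV (gtr0_norm (s0 j)).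
rewrite (_ : _ * _ * _ = `|x 0 j| * `|y 0 j|); last by field; rewrite gt_eqF.
by rewrite -normrM ler_norm.
Qed.

Lemma lp_ellipsoid0 (R : realType) (m : nat) (p : \bar R) (sigma : 'I_m -> R) :
  (1 <= p)%E -> lp_ellipsoid p sigma 0.
Proof.
move=> p1; rewrite /lp_ellipsoid/=.
have -> : \row_(j < m) ((0 : 'rV[R]_m) 0 j / sigma j) = 0.
  by apply/rowP => j; rewrite !mxE mul0r.
case: p p1 => [r| |]//=; last first.
  by move=> _; apply/bigmax_leP; split=> // j _; rewrite mxE normr0.
rewrite lee_fin => r1; have r0 : r != 0 by rewrite gt_eqF// (lt_le_trans _ r1).
rewrite big1 ?powR0 ?invr_eq0// => j _.
by rewrite mxE normr0 powR0.
Qed.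

(** The right-hand side is N times a convex combination of the exp(x_j^2/4),
    with N the scale at which [lp_ball_young] applies to sigma_j |x_j| / N. *)
Lemma ellipsoid_form_le_gt1 (R : realType) (m : nat) (p : \bar R)
    (sigma : 'I_m -> R) (x y : 'rV[R]_m)
    (q := fine (hoelder_conjugate p)) (A := \sum_(j < m) sigma j `^ q) :
  (0 < m)%N -> (1 < p)%E -> (forall j, 0 < sigma j) -> lp_ellipsoid p sigma y ->
  \sum_(j < m) x 0 j * y 0 j <=
  \sum_(j < m) (Num.sqrt (2 * q) * A `^ q^-1 * (sigma j `^ q / A))
     * expR (x 0 j ^+ 2 / 4).
Proof.
move=> m0 p1 s0 Ey; apply: le_trans (sum_mul_div_le x y s0) _.
have q0 : 0 < q.
  have : (1 <= hoelder_conjugate p)%E by rewrite hoelder_conj_ge1// ltW.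
  rewrite /q; case: hoelder_conjugate (@hoelder_conjugate_eqy _ p) => [r _| |]//.
    by rewrite lee_fin; exact: lt_le_trans.
  by move=> /(_ erefl) p1'; rewrite p1' ltxx in p1.
have A0 : 0 < A.
  rewrite /A (bigD1 (Ordinal m0))//= ltr_pwDl ?powR_gt0// sumr_ge0// => j _.
  exact: powR_ge0.
have s2q : 0 < Num.sqrt (2 * q) by rewrite sqrtr_gt0 mulr_gt0.
have Aq : 0 < A `^ q^-1 by rewrite powR_gt0.
set N := Num.sqrt (2 * q) * A `^ q^-1; have N0 : 0 < N by rewrite mulr_gt0.
pose a j := sigma j * `|x 0 j| / N.
rewrite (eq_bigr (fun j => N * (a j * `|(\row_j (y 0 j / sigma j)) 0 j|))); last first.
  by move=> j _; rewrite /a; field; rewrite gt_eqF.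
under [leRHS]eq_bigr do rewrite -mulrA.
rewrite -!mulr_sumr ler_pM2l//; apply: (lp_ball_young p1 Ey) => [j|j|].
- by rewrite /a divr_ge0 ?mulr_ge0// ltW.
- rewrite -/q (_ : a j = (sigma j / A `^ q^-1) * (`|x 0 j| / Num.sqrt (2 * q))); last first.
    by rewrite /a /N; field; rewrite !gt_eqF.
  rewrite powRM ?divr_ge0 ?(ltW (s0 j)) ?(ltW Aq) ?(ltW s2q)//.
  rewrite powRM ?invr_ge0 ?(ltW (s0 j)) ?(ltW Aq)//.
  rewrite -[(A `^ _)^-1]powR_inv1 ?(ltW Aq)// -!powRrM mulN1r mulrN mulVf ?gt_eqF//.
  rewrite powR_inv1 ?(ltW A0)// ler_pM2l ?powR_sqrt_le_expR//.
  by rewrite divr_gt0 ?powR_gt0.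
- rewrite -[leLHS](divff (lt0r_neq0 A0)) {1}/A mulr_suml; apply: ler_sum => j _.
  rewrite ler_peMr ?divr_ge0 ?powR_ge0// ?(ltW A0)//.
  by rewrite -expR0 ler_expR divr_ge0// sqr_ge0.
Qed.

(** * Pointwise bound for p = 1 *)

(** With L = ln k.+1 and t the left-hand side, the last term is
    exp((L + 1) t^2/4 - 2 L). If t > 3 then t^2/4 > 2, so the exponent is at
    least t^2/4, which already exceeds t - 1. *)
Lemma norm_div_sqrt_ln_le (R : realType) (k : nat) (x : R) :
  `|x| / Num.sqrt (ln k.+1%:R + 1) <= 3 + expR (x ^+ 2 / 4) / k.+1%:R ^+ 2.
Proof.
set L : R := ln k.+1%:R; have L0 : 0 <= L by rewrite ln_ge0// ler1n.
have s0 : 0 < Num.sqrt (L + 1) by rewrite sqrtr_gt0; lra.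
set t := `|x| / _; have t0 : 0 <= t by rewrite divr_ge0// ltW.
have xE : x ^+ 2 = (L + 1) * t ^+ 2.
  rewrite /t expr_div_n real_normK ?num_real// sqr_sqrtr; last lra.
  by field; rewrite gt_eqF//; lra.
have -> : expR (x ^+ 2 / 4) / k.+1%:R ^+ 2 = expR (x ^+ 2 / 4 - 2 * L).
  by rewrite expRB mulr_natl mulr2n expRD lnK ?posrE ?ltr0n.
have [t3|t3] := leP t 3.
  by rewrite (le_trans t3)// lerDl expR_ge0.
apply: (@le_trans _ _ (3 + (1 + (x ^+ 2 / 4 - 2 * L)))); last first.
  by rewrite lerD2l expR_ge1Dx.
have t8 : 0 <= t ^+ 2 / 4 - 2 by nra.
have := mulr_ge0 L0 t8; have := sqr_ge0 (t / 2 - 1).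
by rewrite xE; lra.
Qed.

(** Telescoping: 1/(j+1)^2 <= 2/(j+1) - 2/(j+2). *)
Lemma sum_inv_sqr_le2 (R : realType) (m : nat) :
  \sum_(j < m) (j.+1%:R ^+ 2)^-1 <= 2 :> R.
Proof.
suff : \sum_(j < m) (j.+1%:R ^+ 2)^-1 <= 2 - 2 / m.+1%:R :> R.
  by move=> /le_trans; apply; rewrite gerBl divr_ge0.
elim: m => [|m IH]; first by rewrite big_ord0 divr1 subrr.
rewrite big_ord_recr/=; apply: le_trans (lerD IH (lexx _)) _.
have n0 : 1 <= m.+1%:R :> R by rewrite ler1n.
rewrite -[m.+2%:R]natr1; set n : R := m.+1%:R in n0 *.
have n1 : 0 < n by lra.
rewrite -subr_ge0 (_ : _ - _ = (n - 1) / (n ^+ 2 * (n + 1))); last first.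
  by field; rewrite !gt_eqF//; lra.
by rewrite divr_ge0 ?subr_ge0// mulr_ge0 ?sqr_ge0//; lra.
Qed.

(** On the unit l_1-ball a linear form is at most its largest coefficient; each
    coefficient sigma_j |x_j| is bounded by M times the estimate of
    [norm_div_sqrt_ln_le], whose last term is one term of the sum. *)
Lemma ellipsoid_form_le1 (R : realType) (m : nat) (sigma : 'I_m -> R)
    (x y : 'rV[R]_m)
    (M := \big[Num.max/0]_(j < m) (sigma j * Num.sqrt (ln j.+1%:R + 1))) :
  (forall j, 0 < sigma j) -> lp_ellipsoid 1%E sigma y ->
  \sum_(j < m) x 0 j * y 0 j <=
  M * 3 + \sum_(j < m) M * (j.+1%:R ^+ 2)^-1 * expR (x 0 j ^+ 2 / 4).
Proof.
move=> s0 Ey; apply: le_trans (sum_mul_div_le x y s0) _.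
set b := \row_j _ in Ey *.
have M0 : 0 <= M by exact: bigmax_ge_id.
set K := leRHS.
have K0 : 0 <= K.
  rewrite addr_ge0 ?mulr_ge0// sumr_ge0// => j _.
  by rewrite !mulr_ge0 ?expR_ge0// invr_ge0 sqr_ge0.
have {}Ey : \sum_(j < m) `|b 0 j| <= 1.
  move: Ey; rewrite /lp_ellipsoid/= invr1 powRr1 ?sumr_ge0//.
  by under eq_bigr do rewrite powRr1//.
apply: (@le_trans _ _ (\sum_(j < m) K * `|b 0 j|)); last first.
  by rewrite -mulr_sumr ler_piMr.
apply: ler_sum => j _; rewrite ler_wpM2r//.
have L0 : 0 < Num.sqrt (ln j.+1%:R + 1) :> R.
  by rewrite sqrtr_gt0 ltr_wpDl// ln_ge0// ler1n.
apply: (@le_trans _ _ (M * (3 + expR (x 0 j ^+ 2 / 4) / j.+1%:R ^+ 2))).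
  rewrite [leLHS](_ : _ = (sigma j * Num.sqrt (ln j.+1%:R + 1)) *
    (`|x 0 j| / Num.sqrt (ln j.+1%:R + 1))); last by field; rewrite gt_eqF.
  apply: ler_pM => //.
  - by rewrite mulr_ge0// ltW.
  - exact: (le_bigmax _ (fun j : 'I_m => sigma j * Num.sqrt (ln j.+1%:R + 1))).
  - exact: norm_div_sqrt_ln_le.
rewrite mulrDr lerD2l (bigD1 j)//= [leLHS]mulrCA [leLHS]mulrC.
rewrite lerDl sumr_ge0// => i _.
by rewrite !mulr_ge0 ?expR_ge0// invr_ge0 sqr_ge0.
Qed.

(** * The Gaussian width of the ellipsoid *)

Theorem corollary2 (R : realType) :
  exists C : R, 0 < C /\
  forall (p : \bar R) (m : nat) (sigma : 'I_m -> R)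
    (d : measure_display) (T : measurableType d) (P : probability T R)
    (g : 'I_m -> {RV P >-> R}),
    (1 <= p)%E ->
    (0 < m)%N ->
    (forall i j : 'I_m, (i <= j)%N -> sigma j <= sigma i) ->
    (forall j : 'I_m, 0 < sigma j) ->
    mutually_independent g ->
    (forall j : 'I_m, standard_gaussian (g j)) ->
    (\int[P]_w ereal_sup
        [set (\sum_(j < m) g j w * y 0%R j)%:E | y in lp_ellipsoid p sigma]
      <= (C * gaussian_width_bound p sigma)%:E)%E.
Proof.
have s2 : Num.sqrt 2 <= 2 :> R.
  by rewrite -[leRHS]sqr_sqrtr// expr2 ler_peMl// -[leLHS]sqrtr1 ler_sqrt// ler1n.
exists 7; split=> // p m sigma d T P g p1 m0 _ s0 _ gg.
rewrite /gaussian_width_bound; case: (eqVneq p 1%E) => [pE|pn1].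
  set M := \big[Num.max/0]_(j < m) _.
  have M0 : 0 <= M by exact: bigmax_ge_id.
  pose c (j : 'I_m) : R := M * (j.+1%:R ^+ 2)^-1.
  apply: le_trans (gaussian_width_le (a := M * 3) (c := c) gg _ _ _ _) _.
  - exact: lp_ellipsoid0.
  - by rewrite mulr_ge0.
  - by move=> j; rewrite mulr_ge0// invr_ge0 sqr_ge0.
  - by move=> x y; rewrite pE; exact: ellipsoid_form_le1.
  rewrite lee_fin -mulr_sumr.
  have := @sum_inv_sqr_le2 R m; set S := \sum_(j < m) _ => S2.
  have S0 : 0 <= S by apply: sumr_ge0 => j _; rewrite invr_ge0 sqr_ge0.
  have : Num.sqrt 2 * S <= 2 * 2 by exact: ler_pM.
  by move: (Num.sqrt 2 * S) (mulrCA (Num.sqrt 2) M S) => z ->; nra.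
have {}p1 : (1 < p)%E by rewrite lt_neqAle eq_sym pn1.
cbv zeta; set q := fine _; set A := \sum_(j < m) _.
pose c j := Num.sqrt (2 * q) * A `^ q^-1 * (sigma j `^ q / A).
have A0 : 0 <= A by apply: sumr_ge0 => j _; exact: powR_ge0.
apply: le_trans (gaussian_width_le (a := 0) (c := c) gg _ _ _ _) _ => //.
- exact/lp_ellipsoid0/ltW.
- by move=> j; rewrite !mulr_ge0 ?powR_ge0// ?invr_ge0 ?sqrtr_ge0.
- by move=> x y Ey; rewrite add0r; exact: ellipsoid_form_le_gt1.
rewrite lee_fin add0r -mulr_sumr -mulr_suml -/A sqrtrM//.
have [->|An0] := eqVneq A 0.
  by rewrite mul0r !mulr0 mulr_ge0// mulr_ge0 ?sqrtr_ge0 ?powR_ge0.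
rewrite divff// mulr1 !mulrA -expr2 sqr_sqrtr//.
by rewrite -!mulrA ler_wpM2r ?mulr_ge0 ?sqrtr_ge0 ?powR_ge0// ler_nat.
Qed.
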